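(* Let $p$ be an odd prime, $q=p^2$, and let $f\in\mathcal{RF}$ (functions $\mathbb{F}_{p^2}\to\mathbb{F}_p$) with $\varepsilon\in\{\pm1\}$ the sign of its Walsh transform, such that $\varepsilon\eta_0(-1)=-1$. Let $\mathcal{C}_f=\{(af(x)+\mathrm{Tr}_{q/p}(bx)+c)_{x\in\mathbb{F}_q}:a\in\mathbb{F}_p,b\in\mathbb{F}_q,c\in\mathbb{F}_p\}$. Then $\mathcal{C}_f$ is a $(p^2,4,p^2-p-1,p;3)$-LRC and $\mathcal{C}_f^{\perp}$ is a $(p^2,p^2-4,4,p;p^2-p-2)$-LRC. Moreover, $\mathcal{C}_f$ is $k$-optimal, and $\mathcal{C}_f^{\perp}$ is both $k$-optimal and $d$-optimal.
   Context: $\zeta_p=e^{2\pi i/p}$; $\eta_0$ is the quadratic character of $\mathbb{F}_p$; $p^*=(-1)^{(p-1)/2}p$ with $\sqrt{p^*}=\sqrt p$ if $p\equiv1\pmod4$ and $\sqrt{-1}\sqrt p$ otherwise. Weakly regular bent $f:\mathbb{F}_{p^e}\to\mathbb{F}_p$ with sign $\varepsilon$ and dual $f^*$: $\sum_x\zeta_p^{f(x)-\mathrm{Tr}_{p^e/p}(\beta x)}=\varepsilon\sqrt{p^*}^e\zeta_p^{f^*(\beta)}$ for all $\beta$. $\mathcal{RF}$: weakly regular bent $f$ with $f(0)=0$ and $f(ax)=a^hf(x)$ for all $a\in\mathbb{F}_p^*$, $x$, some positive even $h$ with $\gcd(h-1,p-1)=1$. An $(n,k,d,q;r)$-LRC is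 an $[n,k,d]$ linear code over $\mathbb{F}_q$ whose locality is $r$, the locality being the smallest $r$ such that every coordinate $i$ has a set $R_i$ of $r$ other coordinates with $c_i$ a function of $\mathbf{c}_{R_i}$ for all codewords $\mathbf{c}$. $d$-optimal: $d=n-k-\lceil k/r\rceil+2$ (Singleton-like bound met). $k$-optimal: $k=\min_{t\in\mathbb{Z}^+}[rt+k^{(q)}_{opt}(n-t(r+1),d)]$ (Cadambe–Mazumdar bound met), where $k^{(q)}_{opt}(n,d)$ is the largest dimension of a $q$-ary linear code of length $n$ and minimum distance $d$. *)

(* Defs.v *)
From HB Require Import structures.
From mathcomp Require Import all_boot all_order all_algebra all_field.
Set Implicit Arguments. Unset Strict Implicit. Unset Printing Implicit Defensive.
Import Order.TTheory GRing.Theory Num.Theory.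
Local Open Scope ring_scope.

Definition Fp_to (p : nat) (L : fieldType) (a : 'F_p) : L := (nat_of_ord a)%:R.

(* Absolute trace Tr_{p^e/p}(x) = \sum_{i<e} x^(p^i), read back in 'F_p
   (it lies in the prime subfield when #|L| = p^e). *)
Definition trace_Fp (p e : nat) (L : finFieldType) (x : L) : 'F_p :=
  odflt 0 [pick k : 'F_p | Fp_to L k == \sum_(i < e) x ^+ (p ^ i)].

(* zeta_p = e^{2 pi i / p} in algC: p.-root(-1) = e^{i pi / p}. *)
Definition zeta (p : nat) : algC := (p.-root (-1)) ^+ 2.

Definition eta0 (p : nat) (a : 'F_p) : algC :=
  if a == 0 then 0 else if [exists y : 'F_p, y ^+ 2 == a] then 1 else -1.

Definition pstar (p : nat) : algC := (-1) ^+ ((p - 1) %/ 2) * p%:R.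

(* Weakly regular bent with sign eps and dual fstar. sqrt(p^* ) = sqrtC (p^* ),
   which is sqrt p if p^* > 0 and sqrt(-1) sqrt p otherwise. *)
Definition weakly_regular_bent (p e : nat) (L : finFieldType) (f : L -> 'F_p)
    (eps : algC) (fstar : L -> 'F_p) : Prop :=
  (eps = 1 \/ eps = -1) /\
  forall beta : L,
    \sum_(x : L) zeta p ^+ (nat_of_ord (f x - trace_Fp p e (beta * x)))
    = eps * (sqrtC (pstar p)) ^+ e * zeta p ^+ (nat_of_ord (fstar beta)).

Definition in_RF (p e : nat) (L : finFieldType) (f : L -> 'F_p) : Prop :=
  (exists eps fstar, weakly_regular_bent e f eps fstar) /\
  f 0 = 0 /\
  exists h : nat, [/\ (0 < h)%N, ~~ odd h, gcdn h.-1 p.-1 = 1%N &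
    forall (a : 'F_p) (x : L), a != 0 -> f (Fp_to L a * x) = a ^+ h * f x].

Definition is_lincode (p : nat) (I : finType) (C : {set {ffun I -> 'F_p}}) : bool :=
  [&& (0 : {ffun I -> 'F_p}) \in C,
      [forall u in C, forall v in C, (u + v) \in C] &
      [forall a : 'F_p, forall u in C, [ffun i => a * u i] \in C]].

Definition code_dim (p : nat) (I : finType) (C : {set {ffun I -> 'F_p}}) : nat :=
  logn p #|C|.

Definition wt (p : nat) (I : finType) (c : {ffun I -> 'F_p}) : nat :=
  #|[set i | c i != 0]|.

Definition has_mindist (p : nat) (I : finType) (C : {set {ffun I -> 'F_p}}) (d : nat) : bool :=
  [exists c in C, (c != 0) && (wt c == d)] &&
  [forall c in C, (c != 0) ==> (d <= wt c)%N].

Definition dual_code (p : nat) (I : finType) (C : {set {ffun I -> 'F_p}}) :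
  {set {ffun I -> 'F_p}} :=
  [set v : {ffun I -> 'F_p} | [forall c in C, \sum_(i : I) v i * c i == 0]].

Definition recovers (p : nat) (I : finType) (C : {set {ffun I -> 'F_p}}) (i : I) (R : {set I}) : bool :=
  [forall u in C, forall v in C, [forall j in R, u j == v j] ==> (u i == v i)].

Definition has_locality (p : nat) (I : finType) (C : {set {ffun I -> 'F_p}}) (r : nat) : bool :=
  [forall i : I, exists R : {set I}, [&& i \notin R, #|R| == r & recovers C i R]].

Definition locality_is (p : nat) (I : finType) (C : {set {ffun I -> 'F_p}}) (r : nat) : Prop :=
  has_locality C r /\ forall r' : nat, (r' < r)%N -> ~~ has_locality C r'.

Definition is_LRC (p : nat) (I : finType) (C : {set {ffun I -> 'F_p}}) (n k d r : nat) : Prop :=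
  [/\ is_lincode C, #|I| = n, code_dim C = k, has_mindist C d & locality_is C r].

(* Singleton-like bound met: d = n - k - ceil(k/r) + 2 *)
Definition d_optimal (n k d r : nat) : Prop :=
  (d + k + (k + r.-1) %/ r = n + 2)%N.

(* k_opt^{(p)}(m, d): largest dimension of a p-ary linear code of length m with
   minimum distance d (0 if there is none). *)
Definition kopt (p m d : nat) : nat :=
  \max_(C : {set {ffun 'I_m -> 'F_p}} | is_lincode C && has_mindist C d) code_dim C.

(* Cadambe--Mazumdar bound met: k = min_{t >= 1} [r t + k_opt(n - t(r+1), d)],
   t ranging over positive integers with t(r+1) <= n. *)
Definition k_optimal (p n k d r : nat) : Prop :=
  (exists t : nat, [/\ (0 < t)%N, (t * r.+1 <= n)%N & k = (r * t + kopt p (n - t * r.+1) d)%N]) /\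
  (forall t : nat, (0 < t)%N -> (t * r.+1 <= n)%N -> (k <= r * t + kopt p (n - t * r.+1) d)%N).

Definition code_f (p e : nat) (L : finFieldType) (f : L -> 'F_p) : {set {ffun L -> 'F_p}} :=
  [set w : {ffun L -> 'F_p} | [exists a : 'F_p, exists b : L, exists c : 'F_p,
              w == [ffun x => a * f x + trace_Fp p e (b * x) + c]]].

(* Main.v *)
Require Import Defs.
From mathcomp Require Import all_boot all_order all_algebra all_field.
From mathcomp Require Import cyclic zify ring.
Import Order.TTheory GRing.Theory Num.Theory.
Set Implicit Arguments. Unset Strict Implicit. Unset Printing Implicit Defensive.
Local Open Scope ring_scope.

(** As [e = 2], the Walsh values of [f] are [eps p* zeta^(f* b) = -p zeta^(f* b)], with a
    rational factor. Since [1 + X + ... + X^(p-1)] is, up to scaling, the only rational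
    relation of degree less than [p] satisfied by [zeta], the fibres of [f - Tr(b x)] have
    size [1] or [p + 1]. The words of [C_f] are the affine forms [a z + Tr(b x) + c] on the
    graph [z = f x], a set of [p^2] points of AG(3,p), and so every plane meets this graph
    in at most [p + 1] points; counting along the pencil of planes through two of its
    points shows that no three are collinear. Hence [C_f] has distance [p^2 - p - 1], and
    its dual has distance at least [4]. Puncturing [C_f] to the [p + 1] points of a plane
    section and dualizing yields an MDS code of distance [4], which shows that
    [kopt (p + 1) 4 = p - 2] and whose minimum words extend to words of the dual of [C_f].
    The locality of a linear code is read off the supports of its dual words. *)

Lemma sum_card_preim (T U : finType) (g : T -> U) :
  (\sum_y #|[set x | g x == y]| = #|T|)%N.
Proof.
rewrite -[RHS]sum1_card (partition_big g predT) //=.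
by apply: eq_bigr => y _; rewrite sum1dep_card.
Qed.

Lemma exists_set_between (T : finType) (A Z : {set T}) k :
    A \subset Z -> (#|A| <= k <= #|Z|)%N ->
  exists B : {set T}, [/\ A \subset B, B \subset Z & #|B| = k].
Proof.
move=> sAZ /andP[leAk lekZ].
have /card_gt0P[B] :
    (0 < #|[set B : {set T} | B \subset Z :\: A & #|B| == (k - #|A|)%N]|)%N.
  by rewrite cards_draws bin_gt0 cardsD (setIidPr sAZ) leq_sub2r.
rewrite inE subsetD => /andP[/andP[sBZ dBA] /eqP cardB].
exists (A :|: B); split; rewrite ?subsetUl ?subUset ?sAZ //.
by rewrite cardsU setIC disjoint_setI0 // cards0 subn0 cardB subnKC.
Qed.

Definition incl (I : finType) (A : {set I}) (i : {i | i \in A}) : I := val i.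

Lemma incl_inj (I : finType) (A : {set I}) : injective (@incl I A).
Proof. exact: val_inj. Qed.

Lemma card_set_type (I : finType) (A : {set I}) : #|{: {i | i \in A}}| = #|A|.
Proof. by rewrite card_sig. Qed.

Section AdditiveCharacter.

Variable p : nat.
Hypothesis p_pr : prime p.

Lemma ltn_Fp (a : 'F_p) : (a < p)%N.
Proof. by rewrite -[X in (_ < X)%N](Fp_cast p_pr). Qed.

Lemma big_Fp (F : 'F_p -> algC) : \sum_a F a = \sum_(0 <= i < p) F i%:R.
Proof.
rewrite -[X in index_iota _ X](Fp_cast p_pr) big_mkord.
by apply: eq_bigr => a _; rewrite natr_Zp.
Qed.

Lemma zeta_prim : p.-primitive_root (zeta p).
Proof.
have p_gt1 := prime_gt1 p_pr; have p_gt0 := prime_gt0 p_pr.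
have rootp : p.-root (-1 : algC) ^+ p = -1 by rewrite rootCK.
have zetap : zeta p ^+ p = 1 by rewrite /zeta exprAC rootp sqrrN expr1n.
have [m prim_m m_dvd] := prim_order_exists p_gt0 zetap.
have [_ /(_ m m_dvd)/orP[]/eqP mE] := primeP p_pr; last by rewrite -{1}mE.
move: (prim_expr_order prim_m); rewrite mE expr1 /zeta => /eqP.
rewrite sqrf_eq1 => /orP[]/eqP root1.
  by move/eqP: rootp; rewrite root1 expr1n eq_sym eqNr oner_eq0.
by have := rootC_lt0 (-1 : algC) p_gt1; rewrite root1 oppr_lt0 ltr01.
Qed.

Definition chi (a : 'F_p) : algC := zeta p ^+ (nat_of_ord a).

Lemma chi_natr n : chi n%:R = zeta p ^+ n.
Proof. by apply/eqP; rewrite (eq_prim_root_expr zeta_prim) val_Fp_nat ?modn_mod. Qed.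

Lemma chiD : {morph chi : a b / a + b >-> a * b}.
Proof. by move=> a b; rewrite -exprD -chi_natr natrD !natr_Zp. Qed.

Lemma chi_eq1 a : (chi a == 1) = (a == 0).
Proof.
rewrite -[1](expr0 (zeta p)) (eq_prim_root_expr zeta_prim).
by rewrite !modn_small ?ltn_Fp ?prime_gt0.
Qed.

Lemma sum_chi_translate (T : finType) (A : {pred T}) (g : T -> 'F_p) (tau : T -> T) a :
    injective tau -> {mono tau : x / x \in A} ->
    (forall x, g (tau x) = a + g x) -> a != 0 ->
  \sum_(x in A) chi (g x) = 0.
Proof.
move=> tau_inj tauA g_tau a0; set S := \sum_(x in A) _.
have /eqP : S = chi a * S.
  rewrite {1}/S (reindex_inj tau_inj) mulr_sumr.
  by apply: eq_big => [x|x _]; rewrite ?tauA // g_tau chiD.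
rewrite -subr_eq0 -{1}[S]mul1r -mulrBl mulf_eq0 subr_eq0 eq_sym.
by rewrite chi_eq1 (negPf a0) => /eqP.
Qed.

Lemma sum_chi : \sum_a chi a = 0.
Proof. exact: (sum_chi_translate (A := predT) (g := id) (addrI 1) _ _ (oner_neq0 _)). Qed.

Lemma root_zeta_eq0 (q : {poly rat}) :
  (size q < p)%N -> root (map_poly ratr q) (zeta p) -> q = 0.
Proof.
move=> size_q; have [P [PE _] ->] := minCpolyP (zeta p).
have size_P : size P = p.
  rewrite -(size_map_poly (ratr : rat -> algC)) -PE (minCpoly_cyclotomic zeta_prim).
  by rewrite size_cyclotomic totient_prime ?prednK ?prime_gt0.
by apply: contraTeq => q0; apply: contra_ltnN size_q => /(dvdp_leq q0); rewrite size_P.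
Qed.

Lemma chi_rat_relation_const (c : 'F_p -> rat) :
  \sum_a ratr (c a) * chi a = 0 -> forall a b, c a = c b.
Proof.
move=> rel; have p_gt0 := prime_gt0 p_pr.
pose d a := c a - c (-1); pose q := \poly_(i < p.-1) d i%:R.
have rel_d : \sum_a ratr (d a) * chi a = 0.
  under eq_bigr do rewrite rmorphB mulrBl.
  by rewrite sumrB rel -mulr_sumr sum_chi mulr0 subr0.
have natN1 : p.-1%:R = -1 :> 'F_p.
  by apply/eqP; rewrite -addr_eq0 natr1 prednK // pchar_Fp_0.
have root_q : root (map_poly ratr q) (zeta p).
  have -> : map_poly ratr q = \poly_(i < p.-1) (ratr (d i%:R) : algC).
    by apply/polyP=> i; rewrite coef_map !coef_poly; case: ifP; rewrite //= raddf0.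
  rewrite rootE horner_poly -[X in _ == X]rel_d big_Fp; apply/eqP.
  rewrite -[X in index_iota _ X](prednK p_gt0) big_nat_recr //=.
  have -> : d p.-1%:R = 0 by rewrite natN1 /d subrr.
  rewrite rmorph0 mul0r addr0 big_mkord.
  by apply: eq_bigr => i _; rewrite chi_natr.
have q0 : q = 0.
  by apply: root_zeta_eq0 root_q; rewrite (leq_ltn_trans (size_poly _ _)) ?prednK.
have d0 a : d a = 0.
  have [lta|gea] := ltnP a p.-1; last first.
    have -> : a = -1 by rewrite -natN1 -[LHS]natr_Zp; congr _%:R; have := ltn_Fp a; lia.
    exact: subrr.
  by have /polyP/(_ a) := q0; rewrite coef_poly lta coef0 natr_Zp.
by move=> a b; apply: (addIr (- c (-1))); rewrite [LHS]d0 [RHS]d0.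
Qed.

Lemma card_preim_chi_sum (T : finType) (g : T -> 'F_p) (s : int) a0 :
    \sum_x chi (g x) = s%:~R * chi a0 ->
  forall a, p%:Z * #|[set x | g x == a]|%:Z = #|T|%:Z - s + p%:Z * s * (a == a0)%:Z.
Proof.
move=> sum_g a; pose c b : int := #|[set x | g x == b]|%:Z - s * (b == a0)%:Z.
have rel : \sum_b ratr (c b)%:~R * chi b = 0.
  under eq_bigr do rewrite ratr_int rmorphB rmorphM /= mulrBl.
  have sum_eq : \sum_b s%:~R * (b == a0)%:~R * chi b = s%:~R * chi a0.
    by rewrite (bigD1 a0) //= eqxx mulr1 big1 ?addr0 // => b /negPf->; rewrite mulr0 mul0r.
  rewrite sumrB sum_eq -sum_g [X in _ - X](partition_big g predT) //= -sumrB big1 // => b _.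
  rewrite (eq_bigr (fun=> chi b)) => [|x /eqP->//].
  rewrite sumr_const mulr_natl (eq_card (B := [set x | g x == b])) ?subrr // => x.
  by rewrite inE.
have sum_c : \sum_b c b = #|T|%:Z - s.
  rewrite sumrB -(big_morph Posz PoszD (erefl _)) sum_card_preim; congr (_ - _).
  by rewrite (bigD1 a0) //= eqxx mulr1 big1 ?addr0 // => b /negPf->; rewrite mulr0.
have c_const b : c b = c a.
  by apply/(intr_inj (R := rat)); apply: chi_rat_relation_const rel b a.
move: sum_c; under eq_bigr do rewrite c_const.
rewrite sumr_const card_Fp // -mulr_natl /c natz; lia.
Qed.

End AdditiveCharacter.

Section Words.

Variables (p : nat) (I : finType).
Hypothesis p_pr : prime p.
Local Notation word := {ffun I -> 'F_p}.
Implicit Types u v w : word.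

Definition scalew (a : 'F_p) u : word := [ffun i => a * u i].
Definition dotp u v : 'F_p := \sum_i u i * v i.
Definition delta i : word := [ffun j => (j == i)%:R].
Definition supp u : {set I} := [set i | u i != 0].
Definition zeros u : {set I} := [set i | u i == 0].

Lemma scale1w u : scalew 1 u = u.
Proof. by apply/ffunP=> i; rewrite ffunE mul1r. Qed.

Lemma scale0w u : scalew 0 u = 0.
Proof. by apply/ffunP=> i; rewrite !ffunE mul0r. Qed.

Lemma wordB_scalew u v : u - v = scalew (-1) v + u.
Proof. by apply/ffunP=> i; rewrite !ffunE mulN1r addrC. Qed.

Lemma scalewDl a b u : scalew (a + b) u = scalew a u + scalew b u.
Proof. by apply/ffunP=> i; rewrite !ffunE mulrDl. Qed.

Lemma scalewA a b u : scalew a (scalew b u) = scalew (a * b) u.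
Proof. by apply/ffunP=> i; rewrite !ffunE mulrA. Qed.

Definition line u : {set word} := [set scalew a u | a : 'F_p].

Lemma lineP u v : reflect (exists a, v = scalew a u) (v \in line u).
Proof. by apply: (iffP imsetP) => [[a _ ->]|[a ->]]; exists a. Qed.

Lemma wt_supp u : wt u = #|supp u|.
Proof. by []. Qed.

Lemma supp_zeros u : supp u = ~: zeros u.
Proof. by apply/setP=> i; rewrite !inE. Qed.

Lemma wt_zeros u : (wt u + #|zeros u| = #|I|)%N.
Proof. by rewrite wt_supp supp_zeros addnC cardsC. Qed.

Lemma wt_eq0 u : (wt u == 0%N) = (u == 0).
Proof.
rewrite cards_eq0; apply/eqP/eqP=> [/setP u0|->]; last first.
  by apply/setP=> i; rewrite !inE ffunE eqxx.
by apply/ffunP=> i; have := u0 i; rewrite !inE ffunE => /negbFE/eqP.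
Qed.

Lemma word_neq0P u : reflect (exists i, u i != 0) (u != 0).
Proof.
rewrite -wt_eq0 -lt0n; apply: (iffP card_gt0P) => -[i ui]; exists i;
  by rewrite inE in ui *.
Qed.

Lemma scalew_inj u : u != 0 -> injective (scalew^~ u).
Proof.
case/word_neq0P=> i ui a b /ffunP/(_ i); rewrite !ffunE; exact: mulIf.
Qed.

Lemma card_line u : u != 0 -> #|line u| = p.
Proof. by move=> u0; rewrite (card_imset _ (scalew_inj u0)) card_Fp. Qed.

Lemma wt_scalew a u : a != 0 -> wt (scalew a u) = wt u.
Proof. by move=> a0; apply: eq_card => i; rewrite !inE ffunE mulf_eq0 (negPf a0). Qed.

Lemma dotpC u v : dotp u v = dotp v u.
Proof. by apply: eq_bigr => i _; rewrite mulrC. Qed.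

Lemma dotp_linear a u v w : dotp (scalew a u + v) w = a * dotp u w + dotp v w.
Proof.
by rewrite mulr_sumr -big_split; apply: eq_bigr => i _; rewrite !ffunE mulrDl mulrA.
Qed.

Lemma dotp_delta i w : dotp (delta i) w = w i.
Proof.
rewrite /dotp (bigD1 i) //= ffunE eqxx mul1r big1 ?addr0 // => j /negPf ij.
by rewrite ffunE ij mul0r.
Qed.

(* Away from the common zeros of u and v, the pencil s v + u vanishes exactly once at
   each point where v does not, and nowhere else. *)
Lemma card_zeros_pencil u v :
  (\sum_s #|zeros (scalew s v + u)%R| = wt v + p * #|zeros u :&: zeros v|)%N.
Proof.
have cardE (A : pred I) : #|[set i | A i]| = (\sum_i A i)%N.
  by rewrite -sum1dep_card big_mkcond; apply: eq_bigr => i _; case: (A i).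
rewrite /wt [zeros u :&: _]setIdE !cardE.
under eq_bigr do rewrite cardE.
rewrite exchange_big big_distrr -big_split; apply: eq_bigr => i _ /=.
under eq_bigr do rewrite !ffunE addr_eq0.
rewrite !inE; have [vi0|vi0] := eqVneq (v i) 0.
  under eq_bigr do rewrite vi0 mulr0 eq_sym oppr_eq0.
  by rewrite sum_nat_const card_Fp // andbT.
rewrite andbF muln0 addn0 (bigD1 (- u i / v i)) //= divfK // eqxx.
rewrite big1 ?addn0 // => s; apply: contraNeq; rewrite eqb0 negbK => /eqP <-.
by rewrite mulfK.
Qed.

Lemma card_words : #|{: word}| = (p ^ #|I|)%N.
Proof. by rewrite card_ffun card_Fp. Qed.

End Words.

Section LinearCodes.

Variable p : nat.
Hypothesis p_pr : prime p.
Local Notation word I := {ffun I -> 'F_p}.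
Implicit Types I J : finType.

Section Duality.

Variable I : finType.
Implicit Types (u v w : word I) (C : {set word I}).

Lemma lincodeP C :
  reflect (0 \in C /\ forall a, {in C &, forall u v, scalew a u + v \in C}) (is_lincode C).
Proof.
apply: (iffP and3P) => [[C0 CD CZ]|[C0 lin]]; split=> //.
- move=> a u v uC vC.
  have auC : scalew a u \in C by move/forallP: CZ => /(_ a)/forall_inP/(_ u uC).
  by move/forall_inP: CD => /(_ _ auC)/forall_inP/(_ v vC).
- apply/forall_inP=> u uC; apply/forall_inP=> v vC.
  by rewrite -[u]scale1w lin.
- apply/forallP=> a; apply/forall_inP=> u uC.
  by rewrite -/(scalew a u) -[scalew a u]addr0 lin.
Qed.

Lemma lincode0 C : is_lincode C -> 0 \in C.
Proof. by case/lincodeP. Qed.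

Lemma lincode_linear C a u v : is_lincode C -> u \in C -> v \in C -> scalew a u + v \in C.
Proof. by move=> /lincodeP[_ linC] uC vC; apply: linC. Qed.

Lemma lincodeB C u v : is_lincode C -> u \in C -> v \in C -> u - v \in C.
Proof. by rewrite wordB_scalew; move=> linC uC vC; apply: lincode_linear. Qed.

Lemma lincode_addr C u v : is_lincode C -> u \in C -> (u + v \in C) = (v \in C).
Proof.
move=> linC uC; apply/idP/idP=> [uvC|vC].
  by rewrite -(addKr u v) addrC lincodeB.
by rewrite -[u]scale1w lincode_linear.
Qed.

Lemma lincode_setT : is_lincode [set: word I].
Proof. by apply/lincodeP; split=> [|a u v _ _]; rewrite inE. Qed.

Lemma line_lincode u : is_lincode (line u).
Proof.
apply/lincodeP; split; first by apply/lineP; exists 0; rewrite scale0w.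
move=> a _ _ /lineP[b ->] /lineP[b' ->]; apply/lineP; exists (a * b + b').
by rewrite scalewDl scalewA.
Qed.

Lemma dual_codeP C v : reflect {in C, forall c, dotp v c = 0} (v \in dual_code C).
Proof. by rewrite inE; apply: (iffP forall_inP) => vC c /vC/eqP. Qed.

Lemma dual_lincode C : is_lincode (dual_code C).
Proof.
apply/lincodeP; split=> [|a u v /dual_codeP uC /dual_codeP vC]; apply/dual_codeP=> c cC.
  by apply: big1 => i _; rewrite ffunE mul0r.
by rewrite dotp_linear uC // vC // mulr0 addr0.
Qed.

Lemma sum_chi_dotp C v : is_lincode C ->
  \sum_(c in C) chi (dotp v c) = if v \in dual_code C then #|C|%:R else 0.
Proof.
move=> linC; case: ifPn => [/dual_codeP vC|].
  by rewrite (eq_bigr (fun=> 1)) => [|c /vC->//]; rewrite sumr_const.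
rewrite inE negb_forall_in => /exists_inP[c0 c0C vc0].
apply: (sum_chi_translate p_pr (addrI c0) _ _ vc0) => c; first exact: lincode_addr.
by rewrite -/(dotp v c0) ![dotp v _]dotpC -{1}[c0]scale1w dotp_linear mul1r.
Qed.

(* Double counting of the sum of chi <v, c> over all words v and all c in C. *)
Lemma card_dual C : is_lincode C -> (#|C| * #|dual_code C| = p ^ #|I|)%N.
Proof.
move=> linC; apply/eqP; rewrite -(eqr_nat algC); apply/eqP.
transitivity (\sum_v \sum_(c in C) chi (dotp v c)).
  rewrite (eq_bigr _ (fun v _ => sum_chi_dotp v linC)) -big_mkcond /=.
  by rewrite sumr_const natrM mulr_natr.
have sum_v (c : word I) : \sum_v chi (dotp v c) = if c == 0 then (p ^ #|I|)%:R else 0.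
  transitivity (\sum_(v in [set: word I]) chi (dotp c v)).
    by apply: eq_big => [v|v _]; rewrite ?inE // dotpC.
  rewrite (sum_chi_dotp _ lincode_setT) cardsT card_words //; congr (if _ then _ else _).
  apply/dual_codeP/eqP=> [c_orth|-> v _]; last by apply: big1 => i _; rewrite ffunE mul0r.
  by apply/ffunP=> i; rewrite ffunE -(dotp_delta i) dotpC c_orth ?inE.
rewrite exchange_big (eq_bigr _ (fun c _ => sum_v c)).
by rewrite (bigD1 (0 : word I)) ?lincode0 //= eqxx big1 ?addr0 // => c /andP[_ /negPf->].
Qed.

Lemma dualK C : is_lincode C -> dual_code (dual_code C) = C.
Proof.
move=> linC; apply/esym/eqP; rewrite eqEcard; apply/andP; split.
  by apply/subsetP=> c cC; apply/dual_codeP=> v /dual_codeP vC; rewrite dotpC vC.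
have dual_gt0 : (0 < #|dual_code C|)%N.
  by apply/card_gt0P; exists 0; apply/lincode0/dual_lincode.
by rewrite -(leq_pmul2l dual_gt0) (card_dual (dual_lincode C)) mulnC card_dual.
Qed.

Lemma card_lincode C : is_lincode C -> #|C| = (p ^ code_dim C)%N.
Proof.
move=> linC; have : (#|C| %| p ^ #|I|)%N by rewrite -(card_dual linC) dvdn_mulr.
by case/(dvdn_pfactor _ _ p_pr) => k _ cardC; rewrite /code_dim cardC pfactorK.
Qed.

Lemma code_dim_dual C : is_lincode C -> (code_dim C + code_dim (dual_code C) = #|I|)%N.
Proof.
move=> linC; apply/eqP; rewrite -(eqn_exp2l _ _ (prime_gt1 p_pr)) expnD.
by rewrite -!card_lincode ?dual_lincode // card_dual.
Qed.

Lemma code_dim_gt0 C : is_lincode C -> (0 < code_dim C)%N -> exists2 c, c \in C & c != 0.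
Proof.
move=> linC dimC; have /card_gt1P[u [v [uC vC uv]]] : (1 < #|C|)%N.
  by rewrite card_lincode // -(expn0 p) ltn_exp2l ?prime_gt1.
by exists (u - v); rewrite ?lincodeB ?subr_eq0.
Qed.

End Duality.

Section Puncturing.

Variables (I J : finType) (phi : J -> I).
Hypothesis phi_inj : injective phi.
Implicit Types (C : {set word I}) (w : word J).

Definition pull (c : word I) : word J := [ffun j => c (phi j)].
Definition punctured C : {set word J} := pull @: C.
Definition extend w : word I := [ffun i => \sum_(j | phi j == i) w j].

Lemma pull_linear a (u v : word I) : pull (scalew a u + v) = scalew a (pull u) + pull v.
Proof. by apply/ffunP=> j; rewrite !ffunE. Qed.

Lemma pull0 : pull 0 = 0.
Proof. by apply/ffunP=> j; rewrite !ffunE. Qed.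

Lemma punctured_lincode C : is_lincode C -> is_lincode (punctured C).
Proof.
move=> linC; apply/lincodeP; split; first by rewrite -pull0 imset_f ?lincode0.
move=> a _ _ /imsetP[u uC ->] /imsetP[v vC ->].
by rewrite -pull_linear imset_f ?lincode_linear.
Qed.

Lemma dotp_extend w c : dotp (extend w) c = dotp w (pull c).
Proof.
rewrite /dotp [RHS](partition_big phi predT) //=; apply: eq_bigr => i _.
by rewrite ffunE mulr_suml; apply: eq_bigr => j /eqP<-; rewrite ffunE.
Qed.

Lemma extend_dual C w : (extend w \in dual_code C) = (w \in dual_code (punctured C)).
Proof.
apply/dual_codeP/dual_codeP=> [wC _ /imsetP[c cC ->]|wC c cC].
  by rewrite -dotp_extend wC.
by rewrite dotp_extend wC ?imset_f.
Qed.

Lemma extendE w j : extend w (phi j) = w j.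
Proof. by rewrite ffunE (big_pred1 j) // => k; rewrite (inj_eq phi_inj). Qed.

Lemma supp_extend w : supp (extend w) = phi @: supp w.
Proof.
apply/setP=> i; apply/idP/imsetP=> [|[j + ->]]; last by rewrite !inE extendE.
have [j /eqP <-|no] := pickP (fun j => phi j == i).
  by rewrite inE extendE => wj; exists j; rewrite ?inE.
by rewrite inE ffunE big_pred0 ?eqxx.
Qed.

Lemma wt_extend w : wt (extend w) = wt w.
Proof. by rewrite !wt_supp supp_extend card_imset. Qed.

Lemma code_dim_punctured_lt C c : is_lincode C -> c \in C -> c != 0 -> pull c = 0 ->
  (code_dim (punctured C) < code_dim C)%N.
Proof.
move=> linC cC c0 pullc; rewrite -(ltn_exp2l _ _ (prime_gt1 p_pr)).
rewrite -!card_lincode ?punctured_lincode // ltn_neqAle leq_imset_card andbT.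
apply/imset_injP=> pull_inj; case/eqP: c0.
by apply: pull_inj; rewrite ?lincode0 // pullc pull0.
Qed.

End Puncturing.

Section MinimumDistance.

Variable I : finType.
Implicit Types (u v w : word I) (C : {set word I}).

Definition mindist_ge C d : Prop := {in C, forall c, c != 0 -> (d <= wt c)%N}.

Definition min_words_cover C d : Prop :=
  mindist_ge C d /\ forall i, exists2 c, c \in C & c i != 0 /\ wt c = d.

Lemma has_mindistP C d :
  reflect ((exists2 c, c \in C & c != 0 /\ wt c = d) /\ mindist_ge C d) (has_mindist C d).
Proof.
apply: (iffP andP) => -[].
  move=> /exists_inP[c cC /andP[c0 /eqP cd]] /forall_inP dmin.
  by split=> [|u uC u0]; [exists c|apply: (implyP (dmin u uC))].
case=> c cC [c0 cd] dmin; split; last by apply/forall_inP=> u uC; apply/implyP/dmin.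
by apply/exists_inP; exists c; rewrite ?c0 ?cd ?eqxx.
Qed.

Lemma min_words_cover_mindist C d : (0 < #|I|)%N -> min_words_cover C d -> has_mindist C d.
Proof.
move=> /card_gt0P[i _] [dmin /(_ i)[c cC [ci cd]]].
by apply/has_mindistP; split=> //; exists c => //; split=> //; apply/word_neq0P; exists i.
Qed.

(* For the direct implication, puncture C to i |: R: it then misses the word delta i, so
   by biduality some word of the punctured dual is nonzero at i. *)
Lemma recoversP C i (R : {set I}) : is_lincode C -> i \notin R ->
  reflect (exists2 w, w \in dual_code C & w i != 0 /\ supp w \subset i |: R)
    (recovers C i R).
Proof.
move=> linC iR; apply: (iffP forall_inP) => [rec|]; last first.
  move=> [w /dual_codeP wC [wi wR]] u uC.
  apply/forall_inP=> v vC; apply/implyP=> /forall_inP uvR.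
  have: dotp w (u - v) = 0 by rewrite wC ?lincodeB.
  rewrite /dotp (bigD1 i) //= big1 ?addr0 => [/eqP|j ji].
    by rewrite !ffunE mulf_eq0 (negPf wi) subr_eq0.
  have [->|wj] := eqVneq (w j) 0; first by rewrite mul0r.
  have /uvR/eqP uvj : j \in R.
    by have := subsetP wR j; rewrite !inE wj (negPf ji) => /(_ isT).
  by rewrite !ffunE uvj subrr mulr0.
pose phi : {j | j \in i |: R} -> I := @incl I _.
have phi_inj : injective phi := @incl_inj I _.
pose i0 : {j | j \in i |: R} := exist _ i (setU11 i R).
have : delta p i0 \notin dual_code (dual_code (punctured phi C)).
  rewrite dualK ?punctured_lincode //; apply/imsetP=> -[c cC /ffunP cE].
  have ci : c i = 1 by have := cE i0; rewrite !ffunE eqxx.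
  have c_R : [forall j in R, c j == (0 : word I) j].
    apply/forall_inP=> j jR; have /negPf ji : j != i by apply: contraNneq iR => <-.
    by have := cE (exist _ j (setU1r i jR)); rewrite !ffunE -val_eqE /= ji => <-.
  have /forall_inP/(_ 0 (lincode0 linC))/implyP/(_ c_R) := rec c cC.
  by rewrite ci ffunE oner_eq0.
rewrite inE negb_forall_in => /exists_inP[w wD]; rewrite -/(dotp _ w) dotp_delta => wi0.
exists (extend phi w); first by rewrite extend_dual.
split; first by rewrite -[i]/(phi i0) extendE.
by rewrite supp_extend //; apply/subsetP=> _ /imsetP[j _ ->]; apply: valP.
Qed.

Lemma min_words_cover_locality C r :
  is_lincode C -> (0 < #|I|)%N -> min_words_cover (dual_code C) r.+1 -> locality_is C r.
Proof.
move=> linC /card_gt0P[i _] [dmin cover]; split.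
  apply/forallP=> j; have [w wD [wj wr]] := cover j.
  have jw : j \in supp w by rewrite inE.
  apply/existsP; exists (supp w :\ j); rewrite setD11 /=; apply/andP; split.
    by move: wr; rewrite wt_supp (cardsD1 j) jw add1n => -[->].
  by apply/recoversP; rewrite ?setD11 //; exists w; rewrite // setD1K.
move=> r' lt_r'r; apply/forallP=> /(_ i)/existsP[R /and3P[iR /eqP cardR]].
move=> /(recoversP linC iR)[w wD [wi /subset_leq_card]].
have w0 : w != 0 by apply/word_neq0P; exists i.
by rewrite cardsU1 iR cardR -wt_supp; have := dmin w wD w0; lia.
Qed.

Lemma dual_pair_is_LRC C d r : is_lincode C -> (0 < #|I|)%N ->
    min_words_cover C d.+1 -> min_words_cover (dual_code C) r.+1 ->
  is_LRC C #|I| (code_dim C) d.+1 r /\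
  is_LRC (dual_code C) #|I| (#|I| - code_dim C) r.+1 d.
Proof.
move=> linC I_gt0 coverC coverD; have linD := dual_lincode C.
split; split=> //; rewrite -?(code_dim_dual linC) ?addKn //;
  by [apply: min_words_cover_mindist|apply: min_words_cover_locality; rewrite ?dualK].
Qed.

Lemma dual_mindist_ge C k : (k < #|I|)%N ->
    (forall (A : {set I}) z, #|A| = k -> z \notin A ->
      exists2 c, c \in C & A \subset zeros c /\ c z != 0) ->
  mindist_ge (dual_code C) k.+2.
Proof.
move=> lt_kI separated w /dual_codeP wC /word_neq0P[z wz].
rewrite ltnNge; apply/negP=> wt_w.
have suppDz : supp w :\ z \subset [set~ z].
  by apply/subsetP=> i; rewrite !inE => /andP[].
have [|A [wA Az cardA]] := exists_set_between (k := k) suppDz.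
  rewrite wt_supp (cardsD1 z) inE wz !ltnS in wt_w.
  by rewrite wt_w cardsC1 -ltnS (ltn_predK lt_kI).
have zA : z \notin A by apply/negP=> /(subsetP Az); rewrite !inE eqxx.
have [c cC [Ac cz]] := separated A z cardA zA.
have /eqP := wC c cC; rewrite /dotp (bigD1 z) //= big1 ?addr0 => [|i iz].
  by rewrite mulf_eq0 (negPf wz) (negPf cz).
have [->|wi] := eqVneq (w i) 0; first by rewrite mul0r.
have /(subsetP Ac) : i \in A by apply: (subsetP wA); rewrite !inE iz.
by rewrite inE => /eqP->; rewrite mulr0.
Qed.

Lemma lincode_supp_subset C (B : {set I}) :
    is_lincode C -> (#|I| < code_dim C + #|B|)%N ->
  exists2 c, c \in C & c != 0 /\ supp c \subset B.
Proof.
move=> linC; pose phi : {i | i \in ~: B} -> I := @incl I _.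
have [/existsP[c /and3P[cC c0 cB]] _|none] :=
  boolP [exists c in C, (c != 0) && (supp c \subset B)]; first by exists c.
have pull_inj : {in C &, injective (pull phi)}.
  move=> u v uC vC /ffunP uv; apply/eqP; rewrite -subr_eq0.
  apply: contraNT none => uv0; apply/exists_inP; exists (u - v); first exact: lincodeB.
  rewrite uv0; apply/subsetP=> i; rewrite inE; apply: contraR => iB.
  have iBc : i \in ~: B by rewrite inE.
  by have := uv (exist _ i iBc); rewrite !ffunE => ->; rewrite subrr.
have /subset_leq_card := subsetT (pull phi @: C).
rewrite (card_in_imset pull_inj) card_lincode // cardsT card_words // card_set_type.
by rewrite leq_exp2l ?prime_gt1 // -(cardsC B); lia.
Qed.

Lemma singleton_bound C d :
    is_lincode C -> (0 < d <= #|I|.+1)%N -> mindist_ge C d ->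
  (code_dim C + d <= #|I|.+1)%N.
Proof.
move=> linC /andP[d_gt0 d_leI] dmin; rewrite leqNgt; apply/negP=> gt_dim.
have [|B [_ _ cardB]] := exists_set_between (k := d.-1) (sub0set [set: I]).
  by rewrite cards0 cardsT; lia.
have [|c cC [c0 /subset_leq_card]] := lincode_supp_subset (B := B) linC; first by lia.
by rewrite -wt_supp; have := dmin c cC c0; lia.
Qed.

(* By the Singleton bound, the last condition says that code_dim C + d = #|I| + 1. *)
Definition is_mds C d : Prop :=
  [/\ is_lincode C, mindist_ge C d & (#|I| < code_dim C + d)%N].

Lemma mds_min_words_cover C d : is_mds C d -> (0 < d <= #|I|)%N -> min_words_cover C d.
Proof.
move=> [linC dmin dimC] /andP[d_gt0 d_leI]; split=> // i.
have [|B [iB _ cardB]] := exists_set_between (k := d) (subsetT [set i]).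
  by rewrite cards1 cardsT d_gt0.
have [|c cC [c0 cB]] := lincode_supp_subset (B := B) linC; first by rewrite cardB.
have suppc : supp c = B by apply/eqP; rewrite eqEcard cB cardB dmin.
exists c => //; split; last by rewrite wt_supp suppc.
by move: iB; rewrite sub1set -suppc inE.
Qed.

Lemma code_dim_gt1_mindist C d : is_lincode C -> mindist_ge C d -> (1 < code_dim C)%N ->
  (p.+1 * d <= p * #|I|)%N.
Proof.
move=> linC dmin dim_gt1.
have [v vC v0] := code_dim_gt0 linC (ltnW dim_gt1).
have [u uC u_line] : exists2 u, u \in C & u \notin line v.
  apply/subsetPn; apply: contraL dim_gt1 => /subset_leq_card.
  by rewrite card_lincode // card_line // -leqNgt -(leq_exp2l _ 1 (prime_gt1 p_pr)) expn1.
have le_sum : (p * d <= \sum_(s : 'F_p) wt (scalew s v + u)%R)%N.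
  rewrite -[X in (X * d)%N](card_Fp p_pr) -sum_nat_const; apply: leq_sum => s _.
  apply: dmin; first exact: lincode_linear.
  apply: contraNneq u_line => /eqP; rewrite addrC addr_eq0 => /eqP->.
  by apply/lineP; exists (- s); apply/ffunP=> i; rewrite !ffunE mulNr.
have : (\sum_(s : 'F_p) (wt (scalew s v + u)%R + #|zeros (scalew s v + u)%R|) = p * #|I|)%N.
  by under eq_bigr do rewrite wt_zeros; rewrite sum_nat_const card_Fp.
rewrite big_split /= card_zeros_pencil // mulSn addnCA => <-.
by rewrite leq_add ?dmin // (leq_trans le_sum) ?leq_addr.
Qed.

End MinimumDistance.

Lemma mds_dual_punctured I J (phi : J -> I) (C : {set word I}) c : injective phi ->
    is_lincode C -> c \in C -> c != 0 -> pull phi c = 0 ->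
    mindist_ge (dual_code C) (code_dim C) ->
  is_mds (dual_code (punctured phi C)) (code_dim C).
Proof.
move=> phi_inj linC cC c0 pullc dmin.
have linP := punctured_lincode phi linC.
split; first exact: dual_lincode.
  move=> w wD w0; rewrite -(wt_extend phi_inj) dmin ?extend_dual //.
  by rewrite -wt_eq0 wt_extend // wt_eq0.
rewrite -(code_dim_dual linP) addnC ltn_add2l.
exact: code_dim_punctured_lt linC cC c0 pullc.
Qed.

Section OptimalDimension.

Variable I : finType.
Implicit Types C : {set word I}.

Lemma kopt_leq m d k :
    (forall C : {set word 'I_m}, is_lincode C -> mindist_ge C d -> (code_dim C <= k)%N) ->
  (kopt p m d <= k)%N.
Proof. by move=> dimC; apply/bigmax_leqP=> C /andP[linC /has_mindistP[_ /dimC->]]. Qed.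

Lemma leq_code_dim_kopt C d :
  is_lincode C -> has_mindist C d -> (code_dim C <= kopt p #|I| d)%N.
Proof.
move=> linC /has_mindistP[[c cC [c0 cd]] dmin].
pose phi (j : 'I_#|I|) : I := enum_val j.
have phi_rank i : phi (enum_rank i) = i := enum_rankK i.
have wt_pull u : wt (pull phi u) = wt u.
  rewrite !wt_supp -(card_imset _ enum_val_inj); apply: eq_card => i.
  apply/imsetP/idP=> [[j + ->]|]; first by rewrite !inE ffunE.
  by rewrite inE => ui; exists (enum_rank i); rewrite ?enum_rankK // inE ffunE phi_rank.
have pull_inj : injective (pull phi).
  move=> u v /ffunP uv; apply/ffunP=> i.
  by have := uv (enum_rank i); rewrite !ffunE phi_rank.
have -> : code_dim C = code_dim (punctured phi C).
  by rewrite /code_dim (card_imset _ pull_inj).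
apply: leq_bigmax_cond; rewrite punctured_lincode //; apply/has_mindistP; split.
  by exists (pull phi c); rewrite ?imset_f // -wt_eq0 wt_pull wt_eq0.
move=> _ /imsetP[u uC ->]; rewrite -wt_eq0 !wt_pull wt_eq0; exact: dmin.
Qed.

Lemma kopt_mds C d :
  is_mds C d -> (0 < d <= #|I|)%N -> kopt p #|I| d = (#|I|.+1 - d)%N.
Proof.
move=> mdsC dI; have [linC dmin dimC] := mdsC; have /andP[d_gt0 d_leI] := dI.
have I_gt0 : (0 < #|I|)%N := leq_trans d_gt0 d_leI.
have C_mindist := min_words_cover_mindist I_gt0 (mds_min_words_cover mdsC dI).
apply/eqP; rewrite eqn_leq; apply/andP; split; last first.
  by have := leq_code_dim_kopt linC C_mindist; lia.
apply: kopt_leq => D linD D_mindist; have := singleton_bound linD _ D_mindist.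
by rewrite card_ord d_gt0 leqW // => /(_ isT); lia.
Qed.

End OptimalDimension.

Lemma kopt_gt0 m d : (0 < d <= m)%N -> (0 < kopt p m d)%N.
Proof.
move=> /andP[d_gt0 d_lem].
have [|A [_ _ cardA]] := exists_set_between (k := d) (sub0set [set: 'I_m]).
  by rewrite cards0 cardsT card_ord.
pose one : word 'I_m := [ffun i => (i \in A)%:R].
have wt_one : wt one = d.
  rewrite -cardA; apply: eq_card => i; rewrite inE ffunE.
  by case: (i \in A); rewrite ?eqxx ?oner_eq0.
have one0 : one != 0 by rewrite -wt_eq0 wt_one -lt0n.
have one_mindist : has_mindist (line one) d.
  apply/has_mindistP; split.
    by exists one => //; apply/lineP; exists 1; rewrite scale1w.
  move=> _ /lineP[a ->]; have [->|a0 _] := eqVneq a 0; first by rewrite scale0w eqxx.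
  by rewrite wt_scalew ?wt_one.
have := leq_code_dim_kopt (line_lincode one) one_mindist.
by rewrite card_ord /code_dim card_line // (pfactorK 1).
Qed.

Lemma kopt_eq1 m d : (0 < d <= m)%N -> (p * m < p.+1 * d)%N -> kopt p m d = 1%N.
Proof.
move=> dm lt_pm; apply/eqP; rewrite eqn_leq kopt_gt0 // andbT.
apply: kopt_leq => C linC dmin; rewrite leqNgt; apply/negP=> dim_gt1.
by have := code_dim_gt1_mindist linC dmin dim_gt1; rewrite card_ord leqNgt lt_pm.
Qed.

End LinearCodes.

Section QuadraticCharacter.

(* A nonzero element is z ^+ i for a primitive root z, and is a square iff i is even. *)
Lemma euler_criterion (F : finFieldType) (a : F) : odd #|F| -> a != 0 ->
  [exists y, y ^+ 2 == a] = (a ^+ (#|F|.-1)./2 == 1).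
Proof.
move=> F_odd a0; have F_gt1 : (1 < #|F|)%N := finNzRing_gt1 F; set m := (#|F|.-1)./2.
have cardF : #|F| = (m * 2).+1 by rewrite /m; lia.
have m_gt0 : (0 < m)%N by lia.
have unitX (y : F) : y != 0 -> y ^+ (m * 2) = 1.
  by move=> y0; apply: (mulfI y0); rewrite mulr1 -exprS -cardF expf_card.
apply/existsP/eqP=> [[y /eqP y2]|am1].
  have y0 : y != 0 by apply: contraNneq a0 => y0; rewrite -y2 y0 expr0n.
  by rewrite -y2 -exprM mulnC unitX.
have [z _ z_prim] : exists2 z : F, z \in enum (predC1 0) & (m * 2).-primitive_root z.
  apply/hasP/has_prim_root; rewrite ?enum_uniq ?muln_gt0 ?m_gt0 //.
    by apply/allP=> y; rewrite mem_enum inE => y0; rewrite unity_rootE unitX.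
  by rewrite -cardE; have := cardC1 (0 : F); rewrite cardF /= => ->.
have [i aE] := prim_rootP z_prim (unitX a a0).
move/eqP: am1; rewrite aE -exprM -(prim_order_dvd z_prim).
rewrite [X in (_ %| X)%N]mulnC dvdn_pmul2l //.
by case/dvdnP=> j ->; exists (z ^+ j); rewrite -exprM.
Qed.

Variable p : nat.
Hypotheses (p_pr : prime p) (p_odd : odd p).

Lemma eta0N1 : eta0 (-1 : 'F_p) = (-1) ^+ ((p - 1) %/ 2).
Proof.
have p_gt2 := odd_prime_gt2 p_odd p_pr.
have N1_neq1 : (-1 : 'F_p) != 1.
  by rewrite eq_sym -addr_eq0 -(natrD _ 1 1) -(dvdn_pcharf (pchar_Fp p_pr)) gtnNdvd.
rewrite /eta0 oppr_eq0 oner_eq0 /= euler_criterion ?card_Fp // ?oppr_eq0 ?oner_eq0 //.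
rewrite divn2 subn1 -[_ ^+ _]signr_odd -[RHS]signr_odd.
by case: (odd _); rewrite ?eqxx // (negPf N1_neq1).
Qed.

Lemma pstar_eta0 : pstar p = eta0 (-1 : 'F_p) * p%:R.
Proof. by rewrite eta0N1. Qed.

End QuadraticCharacter.

Section PrimeSubfield.

Variables (p : nat) (L : fieldType).
Hypothesis pcharL : p \in [pchar L].

Let p_pr : prime p := pcharf_prime pcharL.
Local Notation emb := (Fp_to L : 'F_p -> L).

Lemma Fp_to_in_alg (a : 'F_p) : emb a = in_alg (pPrimeCharType pcharL) a.
Proof. by rewrite -[LHS]mulr1. Qed.

Lemma Fp_toD : {morph emb : a b / a + b}.
Proof. by move=> a b; rewrite !Fp_to_in_alg rmorphD. Qed.

Lemma Fp_toM : {morph emb : a b / a * b}.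
Proof. by move=> a b; rewrite !Fp_to_in_alg rmorphM. Qed.

Lemma Fp_to_inj : injective emb.
Proof.
move=> a b; rewrite !Fp_to_in_alg.
exact: (@fmorph_inj _ _ (in_alg (pPrimeCharType pcharL))).
Qed.

Lemma Fp_to_eq0 a : (emb a == 0) = (a == 0).
Proof. by rewrite Fp_to_in_alg; exact: (fmorph_eq0 (in_alg (pPrimeCharType pcharL))). Qed.

Lemma Fp_toN1 : emb (-1) = -1.
Proof. by rewrite Fp_to_in_alg rmorphN1. Qed.

Lemma Fp_to_expX (a : 'F_p) i : emb a ^+ (p ^ i) = emb a.
Proof.
elim: i => [|i IHi]; first by rewrite expr1.
by rewrite expnSr exprM IHi -(pFrobenius_autE pcharL) pFrobenius_aut_nat.
Qed.

Lemma Fp_to_frobeniusP (y : L) : reflect (exists a, emb a = y) (y ^+ p == y).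
Proof.
apply: (iffP eqP) => [yp|[a <-]]; last by rewrite -[X in _ ^+ X]expn1 Fp_to_expX.
have := congr1 (map_poly (in_alg (pPrimeCharType pcharL))) (finField_genPoly 'F_p).
rewrite card_Fp // rmorphB rmorph_prod /= map_polyXn map_polyX => genPoly.
have : root ('X^p - 'X : {poly L}) y by rewrite rootE !hornerE yp subrr.
rewrite genPoly rootE horner_prod => /prodf_eq0[a _].
rewrite rmorphB /= map_polyX map_polyC !hornerE subr_eq0 => /eqP ->.
by exists a; rewrite Fp_to_in_alg.
Qed.

End PrimeSubfield.

Section Trace.

Variables (p e : nat) (L : finFieldType).
Hypotheses (p_pr : prime p) (cardL : #|L| = (p ^ e)%N).

Let pcharL : p \in [pchar L] := card_finPcharP cardL p_pr.
Local Notation emb := (Fp_to L : 'F_p -> L).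
Local Notation tr := (@trace_Fp p e L).

Lemma Fp_to_trace x : emb (tr x) = \sum_(i < e) x ^+ (p ^ i).
Proof.
rewrite /trace_Fp; case: pickP => [a /eqP//|none].
pose s := \sum_(i < e) x ^+ (p ^ i).
have /(Fp_to_frobeniusP pcharL)[a aE] : s ^+ p == s.
  rewrite /s -(pFrobenius_autE pcharL) rmorph_sum.
  under eq_bigr do rewrite /= pFrobenius_autE -exprM -expnSr.
  case: e cardL => [|n] cardLn; first by rewrite !big_ord0.
  by rewrite big_ord_recr big_ord_recl /= -cardLn expf_card expr1 addrC.
by have := none a; rewrite aE eqxx.
Qed.

Lemma traceD : {morph tr : x y / x + y}.
Proof.
move=> x y; apply: (Fp_to_inj pcharL); rewrite Fp_toD // !Fp_to_trace -big_split.
by apply: eq_bigr => i _; rewrite exprDn_pchar // pnatX pnatE // pcharL.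
Qed.

Lemma traceZ a x : tr (emb a * x) = a * tr x.
Proof.
apply: (Fp_to_inj pcharL); rewrite Fp_toM // !Fp_to_trace mulr_sumr.
by apply: eq_bigr => i _; rewrite exprMn Fp_to_expX.
Qed.

Lemma trace0 : tr 0 = 0.
Proof. by apply: (addrI (tr 0)); rewrite -traceD !addr0. Qed.

Lemma traceN : {morph tr : x / - x}.
Proof. by move=> x; apply: (addrI (tr x)); rewrite -traceD !subrr trace0. Qed.

Lemma traceB : {morph tr : x y / x - y}.
Proof. by move=> x y; rewrite traceD traceN. Qed.

Lemma trace_surj a : (0 < e)%N -> exists x, tr x = a.
Proof.
move=> e_gt0; pose P : {poly L} := \sum_(i < e) 'X^(p ^ i).
have hornerP x : P.[x] = emb (tr x).
  by rewrite Fp_to_trace horner_sum; apply: eq_bigr => i _; rewrite hornerXn.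
have P0 : P != 0.
  apply: contra_neq (oner_neq0 L) => P0; have := coef0 L 1; rewrite -P0 coef_sum => <-.
  rewrite (bigD1 (Ordinal e_gt0)) //= coefXn eqxx big1 ?addr0 // => i i0.
  rewrite coefXn eq_sym -(expn0 p) eqn_exp2l ?prime_gt1 //.
  by have /negPf-> : (i != 0 :> nat)%N := i0.
have size_P : (size P <= (p ^ e.-1).+1)%N.
  apply: leq_trans (size_sum _ _ _) _; apply/bigmax_leqP=> i _.
  by rewrite size_polyXn ltnS leq_exp2l ?prime_gt1 // -ltnS prednK.
have [t t0] : exists t, tr t != 0.
  apply/existsP; apply: contraLR size_P; rewrite negb_exists -ltnNge => /forallP tr0.
  have : all (root P) (enum L).
    by apply/allP=> x _; rewrite rootE hornerP (eqP (negbNE (tr0 x))).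
  move/(max_poly_roots P0)/(_ (enum_uniq _)); apply: leq_trans.
  rewrite -cardE cardL -{2}(prednK e_gt0) expnS.
  by have := prime_gt1 p_pr; have := expn_gt0 p e.-1; nia.
by exists (emb (a / tr t) * t); rewrite traceZ divfK.
Qed.

Lemma card_trace_preim a : (0 < e)%N -> #|[set x | tr x == a]| = (p ^ e.-1)%N.
Proof.
move=> e_gt0; have card_preim b : #|[set x | tr x == b]| = #|[set x | tr x == 0]|.
  have [y <-] := trace_surj b e_gt0; rewrite -(card_imset _ (addIr (- y))).
  apply: eq_card => x; rewrite inE; apply/imsetP/eqP=> [[z]|x0].
    by rewrite inE => /eqP zy ->; rewrite traceB zy subrr.
  by exists (x + y); rewrite ?addrK // inE traceD x0 add0r.
have := sum_card_preim tr; under eq_bigr do rewrite card_preim.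
rewrite sum_nat_const card_Fp // cardL card_preim -{2}(prednK e_gt0) expnS.
by move/eqP; rewrite eqn_pmul2l ?prime_gt0 // => /eqP.
Qed.

Lemma trace_mulr_eq0 (y : L) : (1 < e)%N -> y != 0 -> exists2 t, t != 0 & tr (t * y) = 0.
Proof.
move=> e_gt1 y0; have := card_trace_preim 0 (ltnW e_gt1).
rewrite (cardsD1 0) inE trace0 eqxx add1n => card_ker.
have /card_gt0P[t] : (0 < #|[set x | tr x == 0%R] :\ 0%R|)%N.
  by rewrite -ltnS card_ker -(expn0 p) ltn_exp2l ?prime_gt1; lia.
rewrite !inE => /andP[t0 /eqP tr_t]; exists (t / y); last by rewrite divfK.
by rewrite mulf_neq0 ?invr_eq0.
Qed.

End Trace.

Section CodeF.

Variables (p e : nat) (L : finFieldType) (f : L -> 'F_p).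
Hypotheses (p_pr : prime p) (cardL : #|L| = (p ^ e)%N).

Let pcharL : p \in [pchar L] := card_finPcharP cardL p_pr.
Local Notation emb := (Fp_to L : 'F_p -> L).
Local Notation tr := (@trace_Fp p e L).

Definition encode (a : 'F_p) (b : L) (c : 'F_p) : {ffun L -> 'F_p} :=
  [ffun x => a * f x + tr (b * x) + c].

Lemma code_fP w : reflect (exists a b c, w = encode a b c) (w \in code_f e f).
Proof.
rewrite inE; apply: (iffP existsP) => [[a /existsP[b /existsP[c /eqP->]]]|[a [b [c ->]]]].
  by exists a, b, c.
by exists a; apply/existsP; exists b; apply/existsP; exists c.
Qed.

Lemma encode_code a b c : encode a b c \in code_f e f.
Proof. by apply/code_fP; exists a, b, c. Qed.

Lemma encode_linear s a b c a' b' c' :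
  scalew s (encode a b c) + encode a' b' c'
    = encode (s * a + a') (emb s * b + b') (s * c + c').
Proof.
apply/ffunP=> x; rewrite !ffunE [(_ + b') * x]mulrDl -[emb s * b * x]mulrA.
by rewrite (traceD p_pr cardL) (traceZ p_pr cardL); ring.
Qed.

Lemma encode0 : encode 0 0 0 = 0.
Proof. by apply/ffunP=> x; rewrite !ffunE !mul0r (trace0 p_pr cardL) !addr0. Qed.

Lemma code_f_lincode : is_lincode (code_f e f).
Proof.
apply/lincodeP; split; first by rewrite -encode0 encode_code.
move=> s _ _ /code_fP[a [b [c ->]]] /code_fP[a' [b' [c' ->]]].
by rewrite encode_linear encode_code.
Qed.

Lemma code_dim_code_f : (forall a b c, encode a b c = 0 -> [/\ a = 0, b = 0 & c = 0]) ->
  code_dim (code_f e f) = e.+2.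
Proof.
move=> ker_encode; pose enc (abc : 'F_p * L * 'F_p) := encode abc.1.1 abc.1.2 abc.2.
have enc_inj : injective enc.
  move=> [[a b] c] [[a' b'] c'] /eqP; rewrite -subr_eq0 wordB_scalew encode_linear => /eqP.
  case/ker_encode=> /= /eqP + /eqP + /eqP.
  by rewrite Fp_toN1 // !mulN1r ![- _ + _]addrC !subr_eq0 => /eqP-> /eqP-> /eqP->.
have -> : code_f e f = enc @: setT.
  apply/setP=> w; apply/code_fP/imsetP=> [[a [b [c ->]]]|[[[a b] c] _ ->]].
    by exists (a, b, c).
  by exists a, b, c.
rewrite /code_dim (card_imset _ enc_inj) cardsT !card_prod card_Fp // cardL.
by rewrite -expnS -expnSr pfactorK.
Qed.

Lemma card_zeros_encode a b c : a != 0 ->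
  #|zeros (encode a b c)| = #|[set x | f x - tr (- b / emb a * x) == - c / a]|.
Proof.
move=> a0; have emb_a0 : emb a != 0 by rewrite Fp_to_eq0.
apply: eq_card => x; rewrite !inE ffunE.
have {1}-> : b * x = emb a * (b / emb a * x) by rewrite mulrA mulrCA divff ?mulr1.
rewrite (traceZ p_pr cardL) !mulNr (traceN p_pr cardL) opprK -mulrDr addr_eq0.
by rewrite -[RHS](inj_eq (mulfI a0)) mulrN mulrCA divff ?mulr1.
Qed.

Lemma card_zeros_trace b c :
  (0 < e)%N -> b != 0 -> #|zeros (encode 0 b c)| = (p ^ e.-1)%N.
Proof.
move=> e_gt0 b0; rewrite -(card_trace_preim p_pr cardL (- c)) //.
rewrite -(card_imset (zeros _) (mulfI b0)); apply: eq_card => y; rewrite inE.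
apply/imsetP/idP=> [[x]|tr_y]; last exists (b^-1 * y); rewrite ?mulVKf //.
  by rewrite inE ffunE mul0r add0r addr_eq0 => tr_bx ->.
by rewrite inE ffunE mul0r add0r addr_eq0 mulVKf.
Qed.

Lemma exists_planes_through x y : (1 < e)%N -> x != y ->
  exists b c d c', [/\ d != 0, [set x; y] \subset zeros (encode 1 b c)
    & [set x; y] \subset zeros (encode 0 d c')].
Proof.
move=> e_gt1 xy; have xy0 : x - y != 0 by rewrite subr_eq0.
have [t tr_t] := trace_surj p_pr cardL (f y - f x) (ltnW e_gt1).
have [d d0 tr_dxy] := trace_mulr_eq0 p_pr cardL e_gt1 xy0.
have tr_y g : tr (g * y) = tr (g * x) - tr (g * (x - y)).
  by rewrite mulrBr (traceB p_pr cardL); ring.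
exists (t / (x - y)), (- f x - tr (t / (x - y) * x)), d, (- tr (d * x)); split=> //;
  apply/subsetP=> z; rewrite !inE => /orP[] /eqP->;
  rewrite ffunE ?tr_y ?divfK ?tr_t ?tr_dxy //;
  by apply/eqP; ring.
Qed.

Lemma zeros_const c : c != 0 -> zeros (encode 0 0 c) = set0.
Proof.
move=> c0; apply/setP=> x; rewrite !inE ffunE !mul0r (trace0 p_pr cardL) !add0r.
exact: negPf.
Qed.

End CodeF.

Section BentCode.

Variables (p : nat) (L : finFieldType) (f fstar : L -> 'F_p).
Hypotheses (p_pr : prime p) (p_odd : odd p) (cardL : #|L| = (p ^ 2)%N).
Hypothesis walsh : forall b,
  \sum_x chi (f x - trace_Fp p 2 (b * x)) = - p%:R * chi (fstar b).

Let p_gt2 : (2 < p)%N := odd_prime_gt2 p_odd p_pr.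
Local Notation tr := (@trace_Fp p 2 L).
Local Notation enc := (@encode p 2 L f).
Local Notation C := (code_f 2 f).
Implicit Types u v w : {ffun L -> 'F_p}.

Lemma card_preim_walsh b a :
  #|[set x | f x - tr (b * x) == a]| = if a == fstar b then 1%N else p.+1.
Proof.
have sum_chi_b : \sum_x chi (f x - tr (b * x)) = (- p%:Z)%:~R * chi (fstar b).
  by rewrite walsh rmorphN.
apply/eqP; rewrite -(eqn_pmul2l (prime_gt0 p_pr)) -eqz_nat PoszM.
by rewrite (card_preim_chi_sum p_pr sum_chi_b) cardL; case: (a == _) => /=; lia.
Qed.

Lemma card_zeros_bent a b c : a != 0 ->
  #|zeros (enc a b c)| = if - c / a == fstar (- b / Fp_to L a) then 1%N else p.+1.
Proof. by move=> a0; rewrite (card_zeros_encode _ p_pr) // card_preim_walsh. Qed.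

Lemma card_zeros_bent_secant a b c x y :
  a != 0 -> x != y -> [set x; y] \subset zeros (enc a b c) -> #|zeros (enc a b c)| = p.+1.
Proof.
move=> a0 xy /subset_leq_card; rewrite cards2 xy card_zeros_bent //.
by case: ifP.
Qed.

Lemma leq_card_zeros_encode a b c : (a, b, c) != 0 -> (#|zeros (enc a b c)| <= p.+1)%N.
Proof.
have [->|a0] := eqVneq a 0; last by rewrite card_zeros_bent //; case: ifP; lia.
have [->|b0] := eqVneq b 0; last by rewrite (card_zeros_trace _ p_pr) // expn1.
have [->|c0] := eqVneq c 0; first by rewrite eqxx.
by rewrite (zeros_const _ p_pr cardL) // cards0.
Qed.

Lemma encode_eq0 a b c : enc a b c = 0 -> [/\ a = 0, b = 0 & c = 0].
Proof.
move=> enc0; have : (#|zeros (enc a b c)| > p.+1)%N.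
  have -> : zeros (enc a b c) = setT by apply/setP=> x; rewrite enc0 !inE ffunE eqxx.
  by rewrite cardsT cardL; nia.
by rewrite ltnNge; have [[-> -> ->]|/leq_card_zeros_encode->] := eqVneq (a, b, c) 0.
Qed.

Lemma code_dim_code_f2 : code_dim C = 4%N.
Proof. exact: (code_dim_code_f p_pr cardL encode_eq0). Qed.

Lemma code_f2_mindist_ge : mindist_ge C (p ^ 2 - p - 1).
Proof.
move=> _ /code_fP[a [b [c ->]]] w0.
have abc0 : (a, b, c) != 0.
  by apply: contraNneq w0 => -[-> -> ->]; rewrite (encode0 _ p_pr).
by have := leq_card_zeros_encode abc0; have := wt_zeros (enc a b c); rewrite cardL; lia.
Qed.

Lemma code_f2_min_words_cover : min_words_cover C (p ^ 2 - p - 1).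
Proof.
split=> [|x]; first exact: code_f2_mindist_ge.
have [c] : exists c, c \notin [set - fstar 0; - f x].
  apply/existsP; rewrite -negb_forall; apply/negP=> /forallP all_c.
  have : [set: 'F_p] \subset [set - fstar 0; - f x] by apply/subsetP.
  by move/subset_leq_card; rewrite cardsT card_Fp // cards2; case: eqP; lia.
rewrite !inE => /norP[c_dual c_fx]; exists (enc 1 0 c); first exact: encode_code.
split; first by rewrite ffunE mul1r mul0r (trace0 p_pr cardL) addr0 addrC addr_eq0.
have : #|zeros (enc 1 0 c)| = p.+1.
  by rewrite card_zeros_bent ?oner_eq0 // divr1 oppr0 mul0r eqr_oppLR (negPf c_dual).
by have := wt_zeros (enc 1 0 c); rewrite cardL; lia.
Qed.

(* The planes through a secant line are u + s v, s in F_p, with p + 1 points each, and v,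
   with p points; as they cover the p^2 points, the line meets the graph only twice. *)
Lemma secant_line x y : x != y ->
  exists u v, [/\ u \in C, v \in C, #|zeros u| = p.+1 & zeros u :&: zeros v = [set x; y]].
Proof.
move=> xy.
have [b [c [d [c' [d0 xy_u xy_v]]]]] :=
  exists_planes_through (e := 2) f p_pr cardL isT xy.
set u := enc 1 b c in xy_u; set v := enc 0 d c' in xy_v.
exists u, v; split; rewrite ?encode_code //; first exact: card_zeros_bent_secant xy_u.
have card_plane s : #|zeros (scalew s v + u)%R| = p.+1.
  rewrite (encode_linear _ p_pr cardL) mulr0 add0r.
  apply: (card_zeros_bent_secant (oner_neq0 _) xy).
  rewrite -[1]add0r -(mulr0 s) -(encode_linear _ p_pr cardL).
  apply/subsetP=> z z_xy; have := subsetP xy_u z z_xy; have := subsetP xy_v z z_xy.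
  by rewrite !inE !ffunE => /eqP-> /eqP->; rewrite mulr0 addr0.
have := card_zeros_pencil p_pr u v; under eq_bigr do rewrite card_plane.
rewrite sum_nat_const card_Fp // => count.
apply/esym/eqP; rewrite eqEcard subsetI xy_u xy_v cards2 xy /=.
have := wt_zeros v; rewrite (card_zeros_trace _ p_pr) // cardL expn1.
rewrite -(leq_pmul2l (prime_gt0 p_pr)) -(leq_add2l (wt v)) -count => wt_v.
by move: (wt v) wt_v => m; lia.
Qed.

Lemma dual_code_f2_mindist_ge : mindist_ge (dual_code C) 4.
Proof.
apply: (dual_mindist_ge (k := 2)) => [|A z /eqP/cards2P[x [y [xy ->]]] z_xy].
  by rewrite cardL; nia.
have [u [v [uC vC _ uv_xy]]] := secant_line xy.
rewrite -uv_xy; move: z_xy; rewrite -uv_xy !inE negb_and => /orP[uz|vz].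
  by exists u; rewrite // subsetIl.
by exists v; rewrite // subsetIr.
Qed.

Lemma plane_neq0 u : #|zeros u| = p.+1 -> u != 0.
Proof.
by move=> card_u; rewrite -wt_eq0; have := wt_zeros u; rewrite card_u cardL; nia.
Qed.

Lemma mds_plane_section u : u \in C -> u != 0 ->
  is_mds (dual_code (punctured (@incl L (zeros u)) C)) 4.
Proof.
move=> uC u0; rewrite -code_dim_code_f2.
apply: mds_dual_punctured (@incl_inj _ _) _ uC u0 _ _ => //.
- exact: code_f_lincode cardL.
- by apply/ffunP=> x; have := valP x; rewrite !ffunE inE => /eqP.
- by rewrite code_dim_code_f2; apply: dual_code_f2_mindist_ge.
Qed.

Lemma dual_code_f2_min_words_cover : min_words_cover (dual_code C) 4.
Proof.
split=> [|x]; first exact: dual_code_f2_mindist_ge.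
have /card_gt0P[y] : (0 < #|[set~ x]|)%N by rewrite cardsC1 cardL; nia.
rewrite !inE eq_sym => /secant_line[u [v [uC _ card_u uv_xy]]].
have x_u : x \in zeros u by have := set21 x y; rewrite -uv_xy inE => /andP[].
have cardJ : #|{: {x | x \in zeros u}}| = p.+1 by rewrite card_set_type.
have [|_ /(_ (exist _ x x_u))[w wD [wx w4]]] :=
    mds_min_words_cover p_pr (mds_plane_section uC (plane_neq0 card_u)) _.
  by rewrite cardJ; lia.
exists (extend (@incl L (zeros u)) w); first by rewrite extend_dual.
rewrite (wt_extend (@incl_inj _ _)) -[x]/(incl (exist _ x x_u)) extendE //.
exact: incl_inj.
Qed.

Lemma kopt_plane_section : kopt p p.+1 4 = (p - 2)%N.
Proof.
have [x [y xy]] : exists x y : L, x != y by exists 0, 1; rewrite eq_sym oner_neq0.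
have [u [_ [uC _ card_u _]]] := secant_line xy.
have cardJ : #|{: {x | x \in zeros u}}| = p.+1 by rewrite card_set_type.
have := kopt_mds p_pr (mds_plane_section uC (plane_neq0 card_u)).
by rewrite cardJ => ->; lia.
Qed.

End BentCode.

Lemma weakly_regular_bent2_walsh p (L : finFieldType) (f fstar : L -> 'F_p) eps b :
    prime p -> odd p -> weakly_regular_bent 2 f eps fstar -> eps * eta0 (-1 : 'F_p) = -1 ->
  \sum_x chi (f x - trace_Fp p 2 (b * x)) = - p%:R * chi (fstar b).
Proof.
move=> p_pr p_odd [_ bent] eps_eta; rewrite /chi bent sqrtCK pstar_eta0 // mulrA eps_eta.
by rewrite mulN1r.
Qed.

Lemma k_optimal_one_group p n k d r :
    (r < n)%N -> (k <= 2 * r)%N -> k = (r + kopt p (n - r.+1) d)%N ->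
  k_optimal p n k d r.
Proof.
move=> lt_rn le_k2r kE; split; first by exists 1%N; rewrite mul1n muln1.
move=> t t_gt0 _; have [->|t_neq1] := eqVneq t 1%N; first by rewrite mul1n muln1 -kE.
by apply: leq_trans le_k2r (leq_trans _ (leq_addr _ _)); rewrite mulnC leq_mul2l; lia.
Qed.

Lemma d_optimal_two_groups n k d r :
  (r < k <= 2 * r)%N -> (d + k = n)%N -> d_optimal n k d r.
Proof.
move=> /andP[lt_rk le_k2r] <-; rewrite /d_optimal.
have -> : (k + r.-1 = 2 * r + (k - r.+1))%N by lia.
by rewrite divnMDl ?divn_small ?addn0 //; lia.
Qed.

Unset Implicit Arguments.

Theorem theorem4p9 (p : nat) (L : finFieldType) (f : L -> 'F_p)
    (eps : algC) (fstar : L -> 'F_p) :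
  prime p -> odd p -> #|L| = (p ^ 2)%N ->
  in_RF 2 f -> weakly_regular_bent 2 f eps fstar ->
  eps * eta0 (-1 : 'F_p) = -1 ->
  [/\ is_LRC (code_f 2 f) (p ^ 2) 4 (p ^ 2 - p - 1) 3,
      is_LRC (dual_code (code_f 2 f)) (p ^ 2) (p ^ 2 - 4) 4 (p ^ 2 - p - 2),
      k_optimal p (p ^ 2) 4 (p ^ 2 - p - 1) 3,
      k_optimal p (p ^ 2) (p ^ 2 - 4) 4 (p ^ 2 - p - 2) &
      d_optimal (p ^ 2) (p ^ 2 - 4) 4 (p ^ 2 - p - 2)].
Proof.
move=> p_pr p_odd cardL _ bent eps_eta.
have p_gt2 := odd_prime_gt2 p_odd p_pr.
have walsh b := weakly_regular_bent2_walsh b p_pr p_odd bent eps_eta.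
have dist_succ : (p ^ 2 - p - 1 = (p ^ 2 - p - 2).+1)%N by nia.
have linC : is_lincode (code_f 2 f) := code_f_lincode f p_pr cardL.
have coverC := code_f2_min_words_cover p_pr p_odd cardL walsh; rewrite dist_succ in coverC.
have coverD := dual_code_f2_min_words_cover p_pr p_odd cardL walsh.
have [|lrcC lrcD] := dual_pair_is_LRC p_pr linC _ coverC coverD.
  by rewrite cardL; nia.
rewrite cardL (code_dim_code_f2 p_pr p_odd cardL walsh) -dist_succ in lrcC lrcD.
split=> //.
- by apply: k_optimal_one_group; rewrite ?kopt_eq1 //; nia.
- apply: k_optimal_one_group; [nia|nia|rewrite -dist_succ].
  have -> : (p ^ 2 - (p ^ 2 - p - 1) = p.+1)%N by nia.
  by rewrite (kopt_plane_section p_pr p_odd cardL walsh); nia.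
- by apply: d_optimal_two_groups; nia.
Qed.
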